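(* Let $f:\mathbb R^n\to\mathbb R$ be locally Lipschitz, $C\subset\mathbb R^n$ closed convex, $\mathscr O$ a cutting plane oracle for $f$, and consider the inner loop (described in the context) at $x\in C$ with matrix $Q\succ0$. Fix a sequence $\nu_k\to0^+$ and suppose the trial points $z^k\in C$ satisfy the stronger condition $$z^k\in B(y^k,\nu_k),\quad f(x)-\Phi_k(z^k,x)\ge\theta\,(f(x)-\Phi_k(y^k,x)),\quad \|z^k-x\|\le\Theta\|y^k-x\|.$$ Suppose that in case of a null step $z^k$ the cutting planes are generated at $z^k$ and the aggregate plane is generated at $y^k$. Suppose the inner loop turns infinitely (no trial step is ever accepted). Then $x$ is a critical point of $\min_C f$, i.e. $0\in\partial f(x)+N_C(x)$.
   Context: $\partial f$ is the Clarke subdifferential, $N_C$ the normal cone, $i_C$ the indicator function of $C$. $\|\cdot\|$ is a fixed norm on $\mathbb R^n$ (the trust-region norm), $B(x,r)$ the closed $\|\cdot\|$-ball. Cutting plane oracle. Fix $M>0$. A cutting plane oracle for $f$ is a set-valued operator $\mathscr O$ on $\mathbb R^n\times\mathbb R^n$ with values nonempty bounded subsets of $\mathbb R\times\mathbb R^n$, bounded on bounded sets; $(a,g)\in\mathscr O(z,x)$ represents the affine function $a+g^{\mathsf T}(\cdot-x)$. It satisfies: $(\mathscr O_1)$ if $(a,g)\in\mathscr O(z,x)$, then $a\le f(x)$; moreover $\mathscr O(x,x)$ contains at least one element $(f(x),g)$ with $g\in\partial f(x)$; $(\mathscr O_2)$ if $(a_j,g_j)\in\mathscr O(z_j,x)$,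 $a_j\to f(x)$, $\|z_j-x\|\le M$, $g_j\to g$, then $g\in\partial f(x)$; $(\mathscr O_3)$ if $z_j\to x$, there exist $(a_j,g_j)\in\mathscr O(z_j,x)$ and $\epsilon_j\to0^+$ with $f(z_j)\le a_j+g_j^{\mathsf T}(z_j-x)+\epsilon_j\|z_j-x\|$; $(\mathscr O_4)$ if $z_j\to z$, $y_j\to y$, $x_j\to x$ with $\|z_j-x_j\|\le M$, and $(a_j,g_j)\in\mathscr O(z_j,x_j)$, then there exist $z'\in B(x,M)$ and $(a',g')\in\mathscr O(z',x)$ with $\limsup_j\,a_j+g_j^{\mathsf T}(y_j-x_j)\le a'+g'^{\mathsf T}(y-x)$. $M$ is understood to be large enough that all points $z$ at which the oracle is called in the inner loop at $x$ satisfy $\|z-x\|\le M$. Inner loop at $x\in C$ with symmetric $Q\succeq0$, $\|Q\|\le q$. Parameters $0<\gamma<\widetilde\gamma<1$, $0<\theta\ll1$, $\Theta\ge1$, $q>0$; initial radius $R_1>0$; $k=1$. At counter $k$ there is a first-order working model $\phi_k(\cdot,x)=\sup\{a+g^{\mathsf T}(\cdot-x):(a,g)\in\mathscr W_k\}$ and a second-order working model $\Phi_k(\cdot,x)=\phi_k(\cdot,x)+\frac12(\cdot-x)^{\mathsf T}Q(\cdot-x)$. $\mathscr W_1$ consists of oracle planes $(a,g)\in\mathscr O(z,x)$ and contains at least one exactness plane, i.e. some $(f(x),g)\in\mathscr O(x,x)$. (Trial step) Compute a solution $y^k$ of the tangent program: minimize $\Phi_k(y,x)$ subject to $y\in C$,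 $\|y-x\|\le R_k$. By optimality there is an aggregate subgradient $g_k^*\in\partial(\phi_k(\cdot,x)+i_C)(y^k)$ with $g_k^*+Q(y^k-x)+v_k=0$, $v_k$ in the normal cone to $B(x,R_k)$ at $y^k$; the aggregate plane (at $y^k$) is $m_k^*(\cdot,x)=\phi_k(y^k,x)+g_k^{*\mathsf T}(\cdot-y^k)$. A trial step $z^k\in C$ is chosen subject to the condition in the claim. (Acceptance) If $\rho_k=\frac{f(x)-f(z^k)}{f(x)-\Phi_k(z^k,x)}\ge\gamma$, then $z^k$ is accepted as new serious iterate and the inner loop ends. (Null step) Otherwise form $\mathscr W_{k+1}$ so that it contains at least one exactness plane $(f(x),g)\in\mathscr O(x,x)$, the aggregate plane $m_k^*$, and all of $\mathscr O(z^k,x)$; any further elements must belong to $\mathscr W_k$ (elements of $\mathscr W_k$ may be dropped). Compute $\widetilde\rho_k=\frac{f(x)-\phi_{k+1}(z^k,x)}{f(x)-\Phi_k(z^k,x)}$, put $R_{k+1}=R_k$ if $\widetilde\rho_k<\widetilde\gamma$, $R_{k+1}=\frac12R_k$ if $\widetilde\rho_k\ge\widetilde\gamma$, and increase $k$. *)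

(* Defs.v *)
From mathcomp Require Import all_boot all_order all_algebra.
From mathcomp Require Import all_classical all_reals all_analysis.
Set Implicit Arguments.
Unset Strict Implicit.
Unset Printing Implicit Defensive.
Import Order.TTheory GRing.Theory Num.Theory.
Import numFieldNormedType.Exports.
Local Open Scope classical_set_scope.
Local Open Scope ring_scope.

(* Vectors of R^n are row vectors, so that the matrix-vector product Q h is
   written h *m Q (Q is always symmetric below).  Topology and boundedness are
   those of the library's normed module structure on 'rV[R]_n (the sup norm);
   the trust-region norm is a separate, arbitrary function N with
   is_norm N. *)

Section convex_and_nonsmooth_analysis.
Context {R : realType} {n : nat}.
Local Notation V := 'rV[R]_n.
Implicit Types (f N : V -> R) (C : set V) (Q : 'M[R]_n) (x y d g h : V).

Definition dot g h : R := (g *m h^T) 0 0.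

Definition quad Q h : R := dot (h *m Q) h.

Definition posdef Q : Prop := Q^T = Q /\ forall h, h != 0 -> 0 < quad Q h.

Record is_norm N : Prop := IsNorm {
  is_norm_triangle : forall g h, N (g + h) <= N g + N h ;
  is_norm_scale : forall (t : R) h, N (t *: h) = `|t| * N h ;
  is_norm_eq0 : forall h, N h = 0 -> h = 0 }.

Definition cball N x (r : R) : set V := [set y | N (y - x) <= r].

Definition opnorm N Q : R := sup [set N (h *m Q) | h in cball N 0 1].

Definition locally_lipschitz f : Prop :=
  forall x, exists2 U : set V, nbhs x U & [lipschitz f y | y in U].

(* limsup of (f (y + t d) - f y) / t as y -> x and t -> 0+ *)
Definition clarke_dd f x d : \bar R :=
  limf_esup (fun w : V * R => ((f (w.1 + w.2 *: d) - f w.1) / w.2)%:E)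
            (filter_prod (nbhs x) (0 : R)^'+).

Definition clarke_subdiff f x : set V :=
  [set g | forall d, ((dot g d)%:E <= clarke_dd f x d)%E].

Definition convex_subdiff (F : V -> \bar R) x : set V :=
  [set g | forall y, (F x + (dot g (y - x))%:E <= F y)%E].

Definition indicator C x : \bar R := if `[< C x >] then 0%E else +oo%E.

Definition normal_cone C x : set V :=
  [set g | C x /\ forall y, C y -> dot g (y - x) <= 0].

Definition critical_point f C x : Prop :=
  [set g + h | g in clarke_subdiff f x & h in normal_cone C x] 0.

End convex_and_nonsmooth_analysis.

Section inner_loop.
Context {R : realType} {n : nat}.
Local Notation V := 'rV[R]_n.
Implicit Types (f N : V -> R) (C : set V) (Q : 'M[R]_n) (x y z g : V).
Implicit Types (O : V -> V -> set (R * V)) (W : set (R * V)) (p : R * V).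

Definition plane x p y : R := p.1 + dot p.2 (y - x).

Record cutting_plane_oracle N (M : R) f O : Prop := CuttingPlaneOracle {
  oracle_neq0 : forall z x, O z x !=set0 ;
  oracle_bounded : forall z x, bounded_set (O z x) ;
  oracle_locally_bounded : forall B : set (V * V),
    bounded_set B -> bounded_set (\bigcup_(w in B) O w.1 w.2) ;
  oracle1 : (forall z x p, O z x p -> p.1 <= f x) /\
    (forall x, exists2 g, O x x (f x, g) & clarke_subdiff f x g) ;
  oracle2 : forall x g (z_ : nat -> V) (p_ : nat -> R * V),
    (forall j, O (z_ j) x (p_ j)) ->
    (p_ j).1 @[j --> \oo] --> f x ->
    (forall j, N (z_ j - x) <= M) ->
    (p_ j).2 @[j --> \oo] --> g ->
    clarke_subdiff f x g ;
  oracle3 : forall x (z_ : nat -> V), z_ @ \oo --> x ->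
    exists (p_ : nat -> R * V) (eps_ : nat -> R),
      [/\ forall j, O (z_ j) x (p_ j),
          eps_ @ \oo --> 0^'+ &
          forall j, f (z_ j) <= plane x (p_ j) (z_ j) + eps_ j * N (z_ j - x)] ;
  oracle4 : forall z y x (z_ y_ x_ : nat -> V) (p_ : nat -> R * V),
    z_ @ \oo --> z -> y_ @ \oo --> y -> x_ @ \oo --> x ->
    (forall j, N (z_ j - x_ j) <= M) ->
    (forall j, O (z_ j) (x_ j) (p_ j)) ->
    exists z' p', [/\ cball N x M z', O z' x p' &
      (limn_esup (fun j => (plane (x_ j) (p_ j) (y_ j))%:E)
         <= (plane x p' y)%:E)%E] }.

(* The sets W to which this is applied are nonempty and bounded, so the
   real-valued sup is the true supremum. *)
Definition model1 W x y : R := sup [set plane x p y | p in W].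

Definition model2 W Q x y : R := model1 W x y + 2^-1 * quad Q (y - x).

Definition exactness_planes f O x : set (R * V) :=
  [set p | O x x p /\ p.1 = f x].

(* The plane model1 W x y + g^T (. - y), re-expanded at x. *)
Definition aggregate_plane W x y g : R * V := (model1 W x y + dot g (x - y), g).

(* W is the working set that produced the trial step z, W' the next one.
   A quotient with zero denominator is 0. *)
Definition rho f W Q x z : R := (f x - f z) / (f x - model2 W Q x z).
Definition rhot f W W' Q x z : R := (f x - model1 W' x z) / (f x - model2 W Q x z).

(* An inner loop at x that turns forever, indexed from 0: W_ k, y_ k, z_ k,
   g_ k, r_ k are the working set, the tangent program solution, the trial
   step, the aggregate subgradient and the radius at counter k+1.  The bounds
   by M say that every point where the oracle is called is within M of x. *)
Record infinite_inner_loop N (M : R) f C O (gamma gammat R1 : R) Q x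
    (W_ : nat -> set (R * V)) (y_ z_ g_ : nat -> V) (r_ : nat -> R) : Prop :=
  InfiniteInnerLoop {
  loop_init_radius : r_ 0%N = R1 ;
  loop_init_oracle : W_ 0%N `<=` \bigcup_(z in cball N x M) O z x ;
  loop_init_exact : W_ 0%N `&` exactness_planes f O x !=set0 ;
  loop_tangent : forall k,
    [/\ C (y_ k), cball N x (r_ k) (y_ k) &
        forall y, C y -> cball N x (r_ k) y ->
          model2 (W_ k) Q x (y_ k) <= model2 (W_ k) Q x y] ;
  loop_subgradient : forall k,
    convex_subdiff (fun y => (model1 (W_ k) x y)%:E + indicator C y)%E
                   (y_ k) (g_ k) /\
    (exists2 v, normal_cone (cball N x (r_ k)) (y_ k) v &
                g_ k + (y_ k - x) *m Q + v = 0) ;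
  loop_trial : forall k, C (z_ k) /\ cball N x M (z_ k) ;
  loop_rejected : forall k, ~ (gamma <= rho f (W_ k) Q x (z_ k)) ;
  loop_exact : forall k, W_ k.+1 `&` exactness_planes f O x !=set0 ;
  loop_aggregate : forall k,
    W_ k.+1 (aggregate_plane (W_ k) x (y_ k) (g_ k)) ;
  loop_cutting : forall k, O (z_ k) x `<=` W_ k.+1 ;
  loop_others : forall k, W_ k.+1 `<=`
    W_ k `|` exactness_planes f O x
      `|` [set aggregate_plane (W_ k) x (y_ k) (g_ k)] `|` O (z_ k) x ;
  loop_radius : forall k,
    r_ k.+1 = if rhot f (W_ k) (W_ k.+1) Q x (z_ k) < gammat then r_ k
              else 2^-1 * r_ k }.

End inner_loop.

(* Main.v *)
Require Import Defs.
From mathcomp Require Import all_boot all_order all_algebra.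
From mathcomp Require Import all_classical all_reals all_analysis.
From mathcomp Require Import ring lra.
Import Order.TTheory GRing.Theory Num.Theory.
Import numFieldNormedType.Exports.
Local Open Scope classical_set_scope.
Local Open Scope ring_scope.

(* Let Delta_k = f(x) - Phi_k(y^k) >= 0 be the predicted decrease and let phi be
   the supremum of all oracle planes at x; on C it dominates every phi_k,
   aggregates included.  Comparing Phi_k(y^k) with Phi_k(x + t (y - x)) shows
   that phi >= f(x) on C as soon as some Delta_k = 0, or R_k stays fixed and
   Delta_k -> 0, or R_k -> 0 and Delta_k = o(R_k) along a subsequence.
   If R_k is halved infinitely often, then z^k -> x, and O3 together with the
   rejection test gives Delta_k = o(R_k) at the halvings.
   If R_k is eventually constant, the aggregate planes make Phi_k(y^k) increase
   by at least 1/2 |y^{k+1} - y^k|_Q^2, so z^k - y^{k+1} -> 0, and the test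
   rho~_k < gamma~ yields Delta_{k+1} <= (gamma~ + o(1)) Delta_k + o(1), so
   Delta_k -> 0.
   Finally, if phi >= f(x) on C, then O2 provides for every y in C a Clarke
   subgradient g in a fixed ball with g^T (y - x) >= 0; a minimax argument makes
   g independent of y, that is, -g in N_C(x). *)

(** * The dot product on row vectors *)

Section euclidean.
Context {R : realType} {n : nat}.
Local Notation V := 'rV[R]_n.
Implicit Types (g h u v : V) (t : R).

Lemma dotE g h : dot g h = \sum_i g 0 i * h 0 i.
Proof. by rewrite /dot mxE; apply: eq_bigr => i _; rewrite mxE. Qed.

Lemma dotC g h : dot g h = dot h g.
Proof. by rewrite !dotE; apply: eq_bigr => i _; rewrite mulrC. Qed.

Lemma dotDl u v h : dot (u + v) h = dot u h + dot v h.
Proof. by rewrite /dot mulmxDl mxE. Qed.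

Lemma dotNl u h : dot (- u) h = - dot u h.
Proof. by rewrite /dot mulNmx mxE. Qed.

Lemma dotZl t u h : dot (t *: u) h = t * dot u h.
Proof. by rewrite /dot -scalemxAl mxE. Qed.

Lemma dotDr h u v : dot h (u + v) = dot h u + dot h v.
Proof. by rewrite dotC dotDl !(dotC h). Qed.

Lemma dotNr h u : dot h (- u) = - dot h u.
Proof. by rewrite dotC dotNl (dotC h). Qed.

Lemma dotZr t h u : dot h (t *: u) = t * dot h u.
Proof. by rewrite dotC dotZl (dotC h). Qed.

Lemma dot0r h : dot h 0 = 0.
Proof. by rewrite -(scale0r (0 : V)) dotZr mul0r. Qed.

Lemma dot_ge0 u : 0 <= dot u u.
Proof. by rewrite dotE sumr_ge0 // => i _; rewrite -expr2 sqr_ge0. Qed.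

Lemma ler_coord_norm u i : `|u 0 i| <= `|u|.
Proof.
rewrite [leRHS]/Num.norm /= mx_normrE.
exact: (le_bigmax _ (fun ij : 'I_1 * 'I_n => `|u ij.1 ij.2|) (0, i)).
Qed.

Lemma ler_norm_coord u t : 0 <= t -> (forall i, `|u 0 i| <= t) -> `|u| <= t.
Proof.
move=> t0 ut; rewrite [leLHS]/Num.norm /= mx_normrE.
apply/bigmax_leP; split => //.
by move=> [i j] _ /=; rewrite ord1.
Qed.

(** The norm on [V] is the sup norm, so each of the n coordinate products is bounded separately;
    this is where the factor [n%:R] in the later estimates originates. *)
Lemma normr_dot_le g h : `|dot g h| <= n%:R * (`|g| * `|h|).
Proof.
rewrite dotE (le_trans (ler_norm_sum _ _ _)) //.
rewrite (@le_trans _ _ (\sum_(i < n) `|g| * `|h|)) //.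
  by apply: ler_sum => i _; rewrite normrM ler_pM // ler_coord_norm.
by rewrite sumr_const card_ord mulr_natl.
Qed.

Lemma dot_norm_le g h : dot g h <= n%:R * (`|g| * `|h|).
Proof. exact: le_trans (ler_norm _) (normr_dot_le g h). Qed.

Lemma sqr_norm_le_dot u : `|u| ^+ 2 <= dot u u.
Proof.
rewrite -(@sqr_sqrtr _ (dot u u)) ?dot_ge0 // lerXn2r ?nnegrE ?sqrtr_ge0 //.
apply: ler_norm_coord => [|i]; first exact: sqrtr_ge0.
rewrite -sqrtr_sqr ler_wsqrtr // dotE (bigD1 i) //= expr2 lerDl.
by apply: sumr_ge0 => j _; rewrite -expr2 sqr_ge0.
Qed.

Lemma cvg_coord {T : Type} (F : set_system T) (FF : Filter F) (a : T -> V) u i :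
  a @ F --> u -> (a x) 0 i @[x --> F] --> u 0 i.
Proof. move=> au; have := @continuous_cvg _ _ _ F FF a (fun w : V => w 0 i) u.
by apply => //; exact: coord_continuous. Qed.

Lemma cvg_dot {T : Type} (F : set_system T) (FF : Filter F) (a b : T -> V) u v :
  a @ F --> u -> b @ F --> v -> dot (a x) (b x) @[x --> F] --> dot u v.
Proof.
move=> au bv; rewrite dotE; under eq_cvg do rewrite dotE.
apply: cvg_big => [|i _]; first by move=> w; exact: add_continuous.
by apply: cvgM; exact: cvg_coord.
Qed.

Lemma cvg_quad {T : Type} (F : set_system T) (FF : Filter F) (Q : 'M[R]_n)
    (a : T -> V) u : a @ F --> u -> quad Q (a x) @[x --> F] --> quad Q u.
Proof.
(* Expanding along the rows of [Q^T] reduces the claim to limits of [dot] and of coordinates. *)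
have quadE h : quad Q h = \sum_i dot h (row i Q^T) * h 0 i.
  rewrite /quad dotE; apply: eq_bigr => i _; congr (_ * _).
  by rewrite dotE mxE; apply: eq_bigr => j _; rewrite !mxE.
move=> au; rewrite quadE; under eq_cvg do rewrite quadE.
apply: cvg_big => [|i _]; first by move=> w; exact: add_continuous.
by apply: cvgM; [apply: cvg_dot => //; exact: cvg_cst|exact: cvg_coord].
Qed.

Lemma quad0 (Q : 'M[R]_n) : quad Q 0 = 0.
Proof. exact: dot0r. Qed.

Lemma quadZ (Q : 'M[R]_n) t u : quad Q (t *: u) = t ^+ 2 * quad Q u.
Proof. by rewrite /quad -scalemxAl dotZl dotZr mulrA -expr2. Qed.

Lemma dot_mulmx_sym (Q : 'M[R]_n) u v :
  Q^T = Q -> dot (u *m Q) v = dot (v *m Q) u.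
Proof. by move=> sQ; rewrite [RHS]dotC /dot trmx_mul sQ mulmxA. Qed.

Lemma quadD (Q : 'M[R]_n) u v : Q^T = Q ->
  quad Q (u + v) = quad Q u + 2 * dot (u *m Q) v + quad Q v.
Proof.
move=> sQ; rewrite /quad mulmxDl !dotDl !dotDr (dot_mulmx_sym _ v u sQ); ring.
Qed.

Lemma posdef_ge0 (Q : 'M[R]_n) u : posdef Q -> 0 <= quad Q u.
Proof.
by move=> [_ Qpos]; have [->|/Qpos/ltW //] := eqVneq u 0; rewrite quad0.
Qed.

End euclidean.

(** * Equivalence of norms *)

Section norm_equivalence.
Context {R : realType} {n : nat}.
Local Notation V := 'rV[R]_n.
Implicit Types (g h u v : V) (t : R).

(** The minimum of [F] on the compact unit sphere serves as [c], and homogeneity carries the bound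
    to all vectors. Degree 2 is used for [quad Q], degree 1 for [N]. *)
Lemma homogeneous_lower_bound (F : V -> R) (p : nat) :
  (0 < p)%N -> continuous F ->
  (forall t h, 0 <= t -> F (t *: h) = t ^+ p * F h) ->
  (forall h, h != 0 -> 0 < F h) ->
  exists2 c : R, 0 < c & forall h, c * `|h| ^+ p <= F h.
Proof.
move=> p0 Fc FZ Fpos.
have F0 : F 0 = 0 by rewrite -(scale0r 0) FZ // expr0n eqn0Ngt p0 mul0r.
pose S := [set h : V | `|h| = 1].
have [S0|S0] := pselect (S !=set0); last first.
  (* An empty sphere means dimension zero: a nonzero [h] could be normalised into it. *)
  exists 1 => // h; have [->|h0] := eqVneq h 0.
    by rewrite F0 normr0 expr0n eqn0Ngt p0 mulr0.
  exfalso; apply: S0; exists (`|h|^-1 *: h).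
  by rewrite /S /= normrZ normfV normr_id mulVf // normr_eq0.
have Scompact : compact S.
  apply: bounded_closed_compact.
    by exists 1; split => // M M1 h /= ->; exact: ltW.
  apply: (@closed_comp _ _ (fun h : V => `|h|) [set 1]); last exact: closed_eq.
  by move=> h _; exact: norm_continuous.
have [h0 Sh0 h0min] := EVT_min_rV S0 Scompact (continuous_subspaceT Fc).
exists (F h0).
  apply: Fpos; apply/eqP => h00; move: Sh0.
  by rewrite inE /S /= h00 normr0 => /esym/eqP; rewrite oner_eq0.
move=> h; have [->|hn0] := eqVneq h 0.
  by rewrite F0 normr0 expr0n eqn0Ngt p0 mulr0.
have h_gt0 : 0 < `|h| by rewrite normr_gt0.
have {2}-> : h = `|h| *: (`|h|^-1 *: h).
  by rewrite scalerA mulfV ?scale1r // gt_eqF.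
rewrite FZ ?normr_ge0 // mulrC ler_wpM2l ?exprn_ge0 // h0min // inE /S /=.
by rewrite normrZ normfV normr_id mulVf // gt_eqF.
Qed.

Lemma posdef_lower_bound (Q : 'M[R]_n) : posdef Q ->
  exists2 c : R, 0 < c & forall h, c * `|h| ^+ 2 <= quad Q h.
Proof.
move=> [_ Qpos]; apply: homogeneous_lower_bound => //.
- by move=> h; exact: (@cvg_quad R n V (nbhs h) _ Q id h cvg_id).
- by move=> t h _; exact: quadZ.
Qed.

Section norm_facts.
Context {N : V -> R} (HN : is_norm N).

Lemma is_norm0 : N 0 = 0.
Proof. by rewrite -(scale0r 0) is_norm_scale // normr0 mul0r. Qed.

Lemma is_normN h : N (- h) = N h.
Proof. by rewrite -scaleN1r is_norm_scale // normrN1 mul1r. Qed.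

Lemma is_norm_ge0 h : 0 <= N h.
Proof.
have := is_norm_triangle HN h (- h); rewrite subrr is_norm0 is_normN; lra.
Qed.

Lemma is_norm_sum (I : Type) (r : seq I) (F : I -> V) :
  N (\sum_(i <- r) F i) <= \sum_(i <- r) N (F i).
Proof.
elim/big_ind2 : _ => [|a a' b b' aa' bb'|//]; first by rewrite is_norm0.
by rewrite (le_trans (is_norm_triangle HN _ _)) // lerD.
Qed.

Lemma is_norm_upper_bound : exists2 c : R, 0 < c & forall h, N h <= c * `|h|.
Proof.
(* The leading 1 keeps the constant positive when the sum is empty. *)
exists (1 + \sum_i N (delta_mx 0 i)).
  by rewrite ltr_pwDl // sumr_ge0 // => i _; exact: is_norm_ge0.
move=> h; rewrite {1}(row_sum_delta h) (le_trans (is_norm_sum _ _ _)) //.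
rewrite mulrDl mul1r ler_wpDl // mulr_suml; apply: ler_sum => i _.
by rewrite is_norm_scale // mulrC ler_wpM2l ?is_norm_ge0 // ler_coord_norm.
Qed.

Lemma is_norm_continuous : continuous N.
Proof.
have [c c0 Nc] := is_norm_upper_bound => u.
apply/(@cvgrPdist_le R R V (nbhs u) _ N (N u)) => e e0.
near=> v; rewrite (@le_trans _ _ (c * `|u - v|)) //.
  rewrite ler_norml; apply/andP; split.
    have := is_norm_triangle HN u (v - u); rewrite addrC subrK.
    have := Nc (v - u); rewrite distrC; lra.
  have := is_norm_triangle HN v (u - v); rewrite addrC subrK.
  have := Nc (u - v); lra.
rewrite -ler_pdivlMl //; near: v.
by apply: cvgr_dist_le; [exact: cvg_id|rewrite mulr_gt0 ?invr_gt0].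
Unshelve. all: by end_near. Qed.

Lemma norm_le_is_norm : exists2 c : R, 0 < c & forall h, `|h| <= c * N h.
Proof.
have [||||c c0 cN] := @homogeneous_lower_bound N 1.
- by [].
- exact: is_norm_continuous.
- by move=> t h t0; rewrite is_norm_scale // ger0_norm // expr1.
- move=> h h0; rewrite lt_neqAle is_norm_ge0 andbT eq_sym.
  by apply: contra h0 => /eqP/(is_norm_eq0 HN)->.
exists c^-1; rewrite ?invr_gt0 // => h.
by rewrite ler_pdivlMl //; have := cN h; rewrite expr1.
Qed.

End norm_facts.
End norm_equivalence.

(** * Projections and a minimax theorem *)

Section minimax.
Context {R : realType} {n : nat}.
Local Notation V := 'rV[R]_n.
Implicit Types (A K S : set V) (d g h u v : V) (t : R).

(** Convexity in the form base point plus [t] times direction, matching the variations [x + t *: d]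
    below. *)
Definition segment_closed A : Prop :=
  forall u v t, A u -> A v -> 0 <= t <= 1 -> A (u + t *: (v - u)).

Lemma convex_set_segment_closed A :
  convex_set (A : set (convex_lmodType V)) -> segment_closed A.
Proof.
move=> Acvx u v t Au Av /andP[t0 t1].
have := @Acvx v u (Itv01 t0 t1); rewrite !inE => /(_ Av Au).
congr A; rewrite /conv /= /unstable.onem scalerBl scale1r scalerBr.
by rewrite addrCA.
Qed.

Lemma bounded_norm_le (r : R) : bounded_set [set h : V | `|h| <= r].
Proof.
exists r; split => [|M rM h /= /le_trans]; first exact: num_real.
by apply; exact: ltW.
Qed.

Lemma closed_norm_le (r : R) : closed [set h : V | `|h| <= r].
Proof.
apply: (@closed_comp _ _ (fun h : V => `|h|) [set s | s <= r]).
  by move=> h _; exact: norm_continuous.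
exact: closed_le.
Qed.

(** Dividing by [t] and letting it tend to 0 gives a first-order condition. Concretely, if [a < 0]
    the chosen [t] has [t * b <= - a], so [2 * a + t * b] would be negative. *)
Lemma quadratic_slope_ge0 (a b : R) :
  (forall t, 0 < t <= 1 -> 0 <= t * (2 * a + t * b)) -> 0 <= a.
Proof.
move=> H; rewrite leNgt; apply/negP => a0.
pose t := Num.min 1 (- a / (1 + `|b|)).
have b1 : 0 < 1 + `|b| by rewrite ltr_pwDl.
have t0 : 0 < t by rewrite lt_min ltr01 divr_gt0 // oppr_gt0.
have t1 : t <= 1 by rewrite ge_min lexx.
have := H t; rewrite t0 t1 => /(_ isT); rewrite pmulr_rge0 // => H0.
have ta : t * (1 + `|b|) <= - a.
  by rewrite -ler_pdivlMr // /t ge_min lexx orbT.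
have : t * b <= t * `|b| by rewrite ler_wpM2l ?ler_norm // ltW.
by move: H0 ta; rewrite mulrDr; lra.
Qed.

(** The squared Euclidean distance to [u] is minimised over a compact sublevel set in [K]; varying
    the minimiser towards [d] yields the variational inequality. *)
Lemma projection_exists K u : closed K -> segment_closed K -> K !=set0 ->
  exists2 p, K p & forall d, K d -> dot (u - p) (d - p) <= 0.
Proof.
move=> Kclosed Kcvx [k0 Kk0].
pose F d := dot (d - u) (d - u).
have Fc : continuous F.
  move=> d; apply: (@cvg_dot R n V (nbhs d)).
    by apply: (@cvgB _ V); [exact: cvg_id|exact: cvg_cst].
  by apply: (@cvgB _ V); [exact: cvg_id|exact: cvg_cst].
pose S := K `&` F @^-1` [set s | s <= F k0].
have Scompact : compact S.
  apply: bounded_closed_compact; last first.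
    apply: closedI => //; apply: closed_comp; last exact: closed_le.
    by move=> d _; exact: Fc.
  exists (1 + F k0 + `|u|); split => [|M MF d /= [_ /= dF]].
    exact: num_real.
  have Fd : `|d - u| <= 1 + F k0.
    have := sqr_norm_le_dot (d - u); rewrite -/(F d) => H.
    have : 0 <= (`|d - u| - 1) ^+ 2 by exact: sqr_ge0.
    by have : 0 <= `|d - u| by []; nra.
  have := ler_normD (d - u) u; rewrite subrK => H.
  by rewrite (le_trans H) // (le_trans _ (ltW MF)) // lerD2r.
have S0 : S !=set0 by exists k0; split => //=.
have [p] := EVT_min_rV S0 Scompact (continuous_subspaceT Fc).
rewrite inE => -[Kp /= pk0] pmin; exists p => // d Kd.
rewrite -oppr_ge0.
apply: (@quadratic_slope_ge0 _ (dot (d - p) (d - p))) => t /andP[t0 t1].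
have Kt : K (p + t *: (d - p)) by apply: Kcvx; rewrite // ltW.
have Fle : F p <= F (p + t *: (d - p)).
  have [le|/ltW ge] := leP (F (p + t *: (d - p))) (F k0).
    by apply: pmin; rewrite inE; split.
  exact: le_trans ge.
have FE : F (p + t *: (d - p)) = F p
    + t * (2 * - dot (u - p) (d - p) + t * dot (d - p) (d - p)).
  rewrite /F (addrAC p) -(opprB p u) dotNl; move: (p - u) (d - p) => a b.
  by rewrite !(dotDl, dotDr, dotZl, dotZr) (dotC b a); ring.
by move: Fle; rewrite FE; lra.
Qed.

(** As [K] may be unbounded, [dot g d] is regularised to [h g d] by adding half of [dot d d]. The
    inner minimum over [K] is then attained at the projection of [- g]. At a maximiser [g] of the
    value [H] the minimiser [d] satisfies [0 <= dot g d], while [H g <= h g 0 = 0]; hence [d = 0],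
    and the projection inequality at 0 is the conclusion. *)
Lemma minimax K S : closed K -> segment_closed K -> K 0 ->
  compact S -> segment_closed S ->
  (forall d, K d -> exists2 g, S g & 0 <= dot g d) ->
  exists2 g, S g & forall d, K d -> 0 <= dot g d.
Proof.
move=> Kclosed Kcvx K0 Scompact Scvx HKS.
have /choice[P PK] u : exists p,
    K p /\ forall d, K d -> dot (u - p) (d - p) <= 0.
  have [|p Kp pP] := projection_exists K u Kclosed Kcvx; first by exists 0.
  by exists p.
(* The projection is nonexpansive in the Euclidean norm; adding the two variational inequalities
   shows it, at the cost of a factor n in the sup norm. *)
have Plip u v : `|P u - P v| <= n%:R * `|u - v|.
  have [KPu HPu] := PK u; have [KPv HPv] := PK v.
  have := HPu _ KPv; have := HPv _ KPu.
  have := sqr_norm_le_dot (P u - P v); have := dot_norm_le (u - v) (P u - P v).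
  have -> : dot (u - P u) (P v - P u) = dot (P u - u) (P u - P v).
    by rewrite -(opprB (P u) (P v)) -(opprB (P u) u) dotNl dotNr opprK.
  set w := P u - P v => H1 H2 H3 H4.
  have H5 : dot w w <= dot (u - v) w.
    by move: H3 H4; rewrite {3}/w !dotDl !dotNl; lra.
  have : `|w| * `|w| <= n%:R * `|u - v| * `|w|.
    by rewrite -expr2 -mulrA; lra.
  have [->|w0] := eqVneq w 0; first by rewrite normr0 mulr_ge0.
  by rewrite ler_pM2r // normr_gt0.
have Pcont : continuous P.
  move=> u; apply/(@cvgrPdist_le R V V (nbhs u) _ P (P u)) => e e0; near=> v.
  rewrite (le_trans (Plip u v)) //.
  rewrite (@le_trans _ _ ((1 + n%:R) * `|u - v|)) //.
    by rewrite ler_wpM2r // lerDr.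
  rewrite -ler_pdivlMl ?ltr_pwDl //; near: v.
  apply: (@cvgr_dist_le _ V V (nbhs u)); first exact: cvg_id.
  by rewrite mulr_gt0 // invr_gt0 ltr_pwDl.
pose h g d := dot g d + 2^-1 * dot d d.
pose H g := h g (P (- g)).
(* Completing the square: [h g d] is half the squared distance from [d] to [- g], up to a term
   independent of [d]. *)
have Hmin g d : K d -> H g <= h g d.
  have [_ HP] := PK (- g); move=> /HP; rewrite /H /h; set p := P (- g).
  have := dot_ge0 (d - p).
  by rewrite !(dotDl, dotDr, dotNl, dotNr) (dotC d p); lra.
have Hc : continuous H.
  move=> g; have Pc : P (- x) @[x --> nbhs g] --> P (- g).
    apply: (@continuous_cvg _ _ _ (nbhs g) _ (fun x : V => - x) P (- g)).
      exact: Pcont.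
    by apply: (@cvgN _ V); exact: cvg_id.
  have dot1 := @cvg_dot R n V (nbhs g) _ id _ _ _ cvg_id Pc.
  have dot2 := @cvg_dot R n V (nbhs g) _ _ _ _ _ Pc Pc.
  apply: (@cvgD _ R^o V (nbhs g) _ (fun x => dot x (P (- x)))).
    exact: dot1.
  by apply: (@cvgM R V (nbhs g)); [exact: cvg_cst|exact: dot2].
have S0 : S !=set0 by have [g Sg _] := HKS _ K0; exists g.
have [g] := EVT_max_rV S0 Scompact (continuous_subspaceT Hc).
rewrite inE => Sg gmax; exists g => //.
(* Danskin: the maximiser g of the concave value function H satisfies
   dot (g' - g) d <= 0 at the corresponding minimiser d. *)
pose d := P (- g).
have slope g' : S g' -> dot (g' - g) d <= 0.
  move=> Sg'; rewrite -oppr_ge0.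
  (* Maximality controls the slope at the perturbed minimiser [dt]; replacing [dt] by [d] costs at
     most [t * b / 2] by [Plip]. *)
  pose b := 2 * (n%:R * (`|g' - g| * (n%:R * `|g' - g|))).
  apply: (@quadratic_slope_ge0 _ b).
  move=> t /andP[t0 t1]; rewrite /b; apply: mulr_ge0; first exact: ltW.
  pose gt := g + t *: (g' - g); pose dt := P (- gt).
  have Sgt : S gt by apply: Scvx; rewrite // ltW.
  have [Kdt _] := PK (- gt).
  have : H gt <= h g dt.
    by apply: (le_trans _ (Hmin g dt Kdt)); apply: gmax; rewrite inE.
  rewrite /H /h -/dt lerD2r {1}/gt dotDl dotZl gerDl pmulr_rle0 // => slt.
  have : `|d - dt| <= n%:R * (t * `|g' - g|).
    rewrite (le_trans (Plip _ _)) // ler_wpM2l // /gt.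
    by rewrite opprK addrC addrAC subrr add0r normrZ gtr0_norm.
  move=> dle; have := dot_norm_le (g' - g) (d - dt); rewrite dotDr dotNr.
  have : n%:R * (`|g' - g| * `|d - dt|)
      <= t * (n%:R * (`|g' - g| * (n%:R * `|g' - g|))).
    have -> : t * (n%:R * (`|g' - g| * (n%:R * `|g' - g|)))
      = n%:R * (`|g' - g| * (n%:R * (t * `|g' - g|))) by ring.
    by rewrite ler_wpM2l // ler_wpM2l.
  lra.
have [Kd dproj] := PK (- g); rewrite -/d in Kd dproj.
have gd_ge0 : 0 <= dot g d.
  have [g' Sg' g'd] := HKS d Kd; have := slope g' Sg'; rewrite dotDl dotNl; lra.
have : H g <= h g 0 by exact: Hmin.
rewrite /H /h -/d !dot0r => Hle.
have d0 : d = 0.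
  have : `|d| ^+ 2 <= 0 by have := sqr_norm_le_dot d; lra.
  by rewrite exprn_even_le0 //= normr_eq0 => /eqP.
by move=> e /dproj; rewrite d0 !subr0 dotNl oppr_le0.
Unshelve. all: by end_near. Qed.

End minimax.

(** * Models and cutting planes *)

Section planes.
Context {R : realType} {n : nat}.
Local Notation V := 'rV[R]_n.
Implicit Types (W : set (R * V)) (p : R * V) (x y z g d : V) (t c : R).

(** For nonempty [W] this makes the [sup] in [model1] a genuine supremum at every point. *)
Definition planes_bounded W x : Prop :=
  forall y, has_ubound [set plane x p y | p in W].

Lemma plane_le_model1 W x p y : planes_bounded W x -> W p ->
  plane x p y <= model1 W x y.
Proof. by move=> Wb Wp; apply: ub_le_sup => //; exists p. Qed.

Lemma model1_le W x y c : W !=set0 -> (forall p, W p -> plane x p y <= c) ->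
  model1 W x y <= c.
Proof.
move=> [p Wp] Wc; apply: ge_sup; first by exists (plane x p y), p.
by move=> _ [p' /Wc ? <-].
Qed.

Lemma plane_at x p : plane x p x = p.1.
Proof. by rewrite /plane subrr dot0r addr0. Qed.

Lemma planeD x p d : plane x p (x + d) = p.1 + dot p.2 d.
Proof. by rewrite /plane (addrC x) addrK. Qed.

Lemma plane_sub x p y z : plane x p y - plane x p z = dot p.2 (y - z).
Proof. by rewrite /plane !(dotDr, dotNr); ring. Qed.

Lemma plane_aggregate W x y g z :
  plane x (aggregate_plane W x y g) z = model1 W x y + dot g (z - y).
Proof. by rewrite /plane /= !(dotDr, dotNr); ring. Qed.

Lemma model1_segment_le W x d c t : planes_bounded W x -> W !=set0 ->
  (forall p, W p -> p.1 <= c) -> 0 <= t <= 1 ->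
  model1 W x (x + t *: d) <= (1 - t) * c + t * model1 W x (x + d).
Proof.
move=> Wb W0 Wc /andP[t0 t1]; apply: model1_le => // p Wp.
have := plane_le_model1 W x p (x + d) Wb Wp.
rewrite !planeD dotZr => pd.
have : t * (p.1 + dot p.2 d) <= t * model1 W x (x + d) by rewrite ler_wpM2l.
have : (1 - t) * p.1 <= (1 - t) * c by rewrite ler_wpM2l ?subr_ge0 ?Wc.
lra.
Qed.

Lemma model2_segment_le W (Q : 'M[R]_n) x d c t :
  (forall h, 0 <= quad Q h) -> planes_bounded W x -> W !=set0 ->
  (forall p, W p -> p.1 <= c) -> 0 <= t <= 1 ->
  model2 W Q x (x + t *: d) <= (1 - t) * c + t * model2 W Q x (x + d).
Proof.
move=> Q0 Wb W0 Wc /[dup] t01 /andP[t0 t1].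
have := model1_segment_le W x d c t Wb W0 Wc t01.
rewrite /model2 !(addrAC x _ (- x)) subrr !add0r quadZ => H.
have : 0 <= t * (1 - t) * quad Q d.
  by apply: mulr_ge0 => //; rewrite mulr_ge0 // subr_ge0.
lra.
Qed.

End planes.

(** * From the oracle planes to criticality *)

Section criticality.
Context {R : realType} {n : nat}.
Local Notation V := 'rV[R]_n.
Implicit Types (x y z g d : V) (t c : R).

(** The subdifferential is an intersection of half-spaces, one per direction, each degenerating to
    everything or nothing where [clarke_dd] is infinite. Closedness below has the same reason. *)
Lemma clarke_subdiff_segment_closed (f : V -> R) x :
  segment_closed (clarke_subdiff f x).
Proof.
move=> u v t; rewrite /clarke_subdiff /= => Hu Hv /andP[t0 t1] d.
move: (Hu d) (Hv d); case: (clarke_dd f x d) => [c| |];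
  [|by move=> _ _; rewrite leey|by rewrite leeNy_eq].
rewrite !lee_fin dotDl dotZl dotDl dotNl => uc vc.
have : (1 - t) * dot u d <= (1 - t) * c by rewrite ler_wpM2l // subr_ge0.
have : t * dot v d <= t * c by rewrite ler_wpM2l.
lra.
Qed.

Lemma clarke_subdiff_closed (f : V -> R) x : closed (clarke_subdiff f x).
Proof.
have -> : clarke_subdiff f x
    = \bigcap_d [set g | ((dot g d)%:E <= clarke_dd f x d)%E].
  by apply/seteqP; split => [g Hg d _|g Hg d]; [exact: Hg|exact: (Hg d)].
apply: closed_bigI => d _; case: (clarke_dd f x d) => [c||].
- rewrite (_ : mkset _ = (fun g => dot g d) @^-1` [set s | s <= c]); last first.
    by apply/seteqP; split => g /=; rewrite lee_fin.
  apply: closed_comp; last exact: closed_le.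
  move=> g _.
  exact: (@cvg_dot R n V (nbhs g) _ id (fun=> d) g d cvg_id (cvg_cst _)).
- rewrite (_ : mkset _ = setT); first exact: closedT.
  by apply/seteqP; split => g //= _; rewrite leey.
- rewrite (_ : mkset _ = set0); first exact: closed0.
  by apply/seteqP; split => g.
Qed.

(** Its upper envelope [model1 (oracle_planes N M O x) x] is the phi of the overview. *)
Definition oracle_planes (N : V -> R) (M : R) (O : V -> V -> set (R * V)) x :
    set (R * V) :=
  \bigcup_(z in cball N x M) O z x.

Context {N : V -> R} (HN : is_norm N) {f : V -> R} {M : R}.
Context {O : V -> V -> set (R * V)}.

Context (HO : cutting_plane_oracle N M f O).

Lemma oracle_planes_slope_bound x :
  exists2 L : R, 0 <= L & forall p, oracle_planes N M O x p -> `|p.2| <= L.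
Proof.
have [c c0 Nc] := norm_le_is_norm HN.
pose B := [set w : V * V | cball N x M w.1 /\ w.2 = x].
have Bb : bounded_set B.
  exists (c * M + `|x|); split => [|K KM [z y] [/= zM ->]].
    exact: num_real.
  rewrite (le_trans _ (ltW KM)) // [leLHS]/Num.norm /= ge_max.
  apply/andP; split.
    have := ler_normD (z - x) x; rewrite subrK => /le_trans; apply.
    by rewrite lerD2r (le_trans (Nc _)) // ler_pM2l.
  rewrite lerDr; apply: mulr_ge0; first exact: ltW.
  have := is_norm_ge0 HN (z - x); move: zM; rewrite /cball /=; lra.
have [L [_ HL]] := oracle_locally_bounded HO Bb.
exists (1 + `|L|) => [|p [z zM Op]]; first by rewrite addr_ge0.
apply: le_trans (HL (1 + `|L|) _ p _).
- by rewrite [leRHS]/Num.norm /= le_max lexx orbT.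
- by have := ler_norm L; lra.
- by exists (z, x).
Qed.

Lemma oracle_planes_le x p : oracle_planes N M O x p -> p.1 <= f x.
Proof. by move=> [z _ /(oracle1 HO).1]. Qed.

Lemma oracle_planes_ubound x : planes_bounded (oracle_planes N M O x) x.
Proof.
have [L L0 HL] := oracle_planes_slope_bound x.
move=> y; exists (f x + n%:R * (L * `|y - x|)) => _ [p Op <-].
rewrite /plane lerD ?oracle_planes_le // (le_trans (dot_norm_le _ _)) //.
by rewrite ler_wpM2l // ler_wpM2r // HL.
Qed.

Lemma oracle_exactness_planes x p : 0 <= M -> exactness_planes f O x p ->
  oracle_planes N M O x p.
Proof.
by move=> M0 [Op _]; exists x => //; rewrite /cball /= subrr is_norm0.
Qed.

Lemma oracle_planes_neq0 x : 0 <= M -> oracle_planes N M O x !=set0.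
Proof.
move=> M0; have [g Og _] := (oracle1 HO).2 x.
by exists (f x, g); apply: oracle_exactness_planes.
Qed.

(** Oracle planes nearly attaining the envelope at [x + t *: d] have intercepts tending to [f x] as
    [t] tends to 0 and slopes whose product with [d] is at least [- t]. A limit of these bounded
    slopes is a Clarke subgradient by [oracle2]. *)
Lemma active_subgradient x d (L : R) : 0 <= M ->
  (forall p, oracle_planes N M O x p -> `|p.2| <= L) ->
  (forall t, 0 <= t <= 1 ->
    f x <= model1 (oracle_planes N M O x) x (x + t *: d)) ->
  exists2 g, clarke_subdiff f x g /\ `|g| <= L & 0 <= dot g d.
Proof.
move=> M0 HL Hd; set A := oracle_planes N M O x.
pose t_ (k : nat) : R := k.+1%:R^-1.
have t0 k : 0 < t_ k by rewrite invr_gt0.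
have t1 k : t_ k <= 1 by rewrite invf_le1 // ler1n.
(* The tolerance [t_ k ^+ 2] still vanishes after division by [t_ k]. *)
have /choice[p_ Hp] k : exists p,
    A p /\ f x - t_ k ^+ 2 <= p.1 + t_ k * dot p.2 d.
  apply: contrapT => nex; have : model1 A x (x + t_ k *: d) <= f x - t_ k ^+ 2.
    apply: model1_le; first exact: oracle_planes_neq0.
    move=> p Ap; rewrite planeD dotZr leNgt; apply/negP => lt.
    by apply: nex; exists p; split => //; exact: ltW.
  have := Hd (t_ k); rewrite t1 ltW // => /(_ isT); rewrite -/A.
  have : 0 < t_ k ^+ 2 by rewrite exprn_gt0.
  lra.
have pL k : `|(p_ k).2| <= L by apply: HL; have [] := Hp k.
have dotp k : - t_ k <= dot (p_ k).2 d.
  have [Ap] := Hp k; have := oracle_planes_le x _ Ap.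
  move=> p1 Hk; have : t_ k * - t_ k <= t_ k * dot (p_ k).2 d by nra.
  by rewrite ler_pM2l.
have Bcompact : compact [set g : V | `|g| <= L].
  apply: bounded_closed_compact; first exact: bounded_norm_le.
  exact: closed_norm_le.
have pF : ((fun k => (p_ k).2) @ \oo) [set g : V | `|g| <= L].
  by exists 0%N => // k _ /=.
have [g [/= gL gcl]] := Bcompact _ _ pF.
(* Extraction of a subsequence of slopes converging to the cluster point [g]. *)
have /choice[m_ Hm] j : exists m : nat, (j <= m)%N /\ `|(p_ m).2 - g| < t_ j.
  have [|_ [[m /= jm <-]]] := gcl [set (p_ m).2 | m in [set m | (j <= m)%N]]
    (ball g (t_ j)) _ (nbhsx_ballx g _ (t0 j)).
    by exists j => // m jm; exists m.
  by rewrite -ball_normE /= distrC => gm; exists m.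
have tm j : t_ (m_ j) <= t_ j.
  by rewrite lef_pV2 ?posrE // ler_nat; have [] := Hm j.
have tcvg : t_ @ \oo --> 0 by exact: cvg_harmonic.
exists g.
  split => //; have zE j : exists z, cball N x M z /\ O z x (p_ (m_ j)).
    by have [[z zM Oz] _] := Hp (m_ j); exists z.
  have /choice[z_ Hz] := zE.
  apply: (@oracle2 _ _ _ _ _ _ HO x g z_ (p_ \o m_)).
  - by move=> j; have [] := Hz j.
  - pose low j := f x - (1 + `|n%:R * (L * `|d|)|) * (t_ j + t_ j).
    apply: (@squeeze_cvgr _ _ _ _ low (fun=> f x)).
    + apply: nearW => j; rewrite /low /=; have [Ap Hk] := Hp (m_ j).
      rewrite oracle_planes_le // andbT.
      have tle : t_ (m_ j) ^+ 2 <= t_ j.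
        rewrite expr2 (le_trans _ (tm j)) // ler_piMl // ltW //.
      have : dot (p_ (m_ j)).2 d <= `|n%:R * (L * `|d|)|.
        apply: le_trans (dot_norm_le _ _) (le_trans _ (ler_norm _)).
        by rewrite ler_wpM2l // ler_wpM2r.
      move: `|n%:R * (L * `|d|)| (normr_ge0 (n%:R * (L * `|d|))) => c c0 pc.
      have : t_ (m_ j) * dot (p_ (m_ j)).2 d <= t_ (m_ j) * c.
        by rewrite ler_wpM2l // ltW.
      have : t_ (m_ j) * c <= t_ j * c by rewrite ler_wpM2r.
      have : 0 <= t_ j * c by rewrite mulr_ge0 // ltW.
      have := t0 j; lra.
    + rewrite -[X in _ --> X]subr0; apply: cvgB; first exact: cvg_cst.
      rewrite -[X in _ --> X](mulr0 (1 + `|n%:R * (L * `|d|)|)).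
      apply: cvgM; first exact: cvg_cst.
      by rewrite -[X in _ --> X](addr0 0); exact: cvgD.
    + exact: cvg_cst.
  - by move=> j; have [] := Hz j.
  - apply/cvgrPdist_lt => e e0; near=> j.
    have [_] := Hm j; rewrite distrC => /lt_trans; apply.
    near: j; have := @cvgr_lt _ _ _ _ _ _ tcvg _ e0; exact.
have lower j : - (t_ j * (1 + n%:R * `|d|)) <= dot g d.
  have [_ gm] := Hm j; have := dot_norm_le ((p_ (m_ j)).2 - g) d.
  rewrite dotDl dotNl; have := dotp (m_ j); have := tm j.
  have : n%:R * (`|(p_ (m_ j)).2 - g| * `|d|) <= t_ j * (n%:R * `|d|).
    by rewrite mulrCA ler_wpM2r ?mulr_ge0 // ltW.
  lra.
have lim0 : - (t_ j * (1 + n%:R * `|d|)) @[j --> \oo] --> 0.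
  rewrite -[X in _ --> X]oppr0 -(mul0r (1 + n%:R * `|d|)).
  by apply: cvgN; apply: cvgM => //; exact: cvg_cst.
by apply: cvgr_to_le lim0 _; exact: nearW.
Unshelve. all: by end_near. Qed.

Lemma critical_point_majorant (C : set V) x : 0 <= M ->
  closed C -> segment_closed C -> C x ->
  (forall y, C y -> f x <= model1 (oracle_planes N M O x) x y) ->
  critical_point f C x.
Proof.
move=> M0 Cclosed Ccvx Cx HC.
have [L L0 HL] := oracle_planes_slope_bound x.
pose S := clarke_subdiff f x `&` [set g | `|g| <= L].
(* [C] is translated by [- x], so that it contains 0. The common slope bound [L] makes [S] compact
   and still admits the subgradients given by [active_subgradient]. *)
have [||||||g [Sg _] gC] := @minimax R n [set d | C (x + d)] S.
- apply: (@closed_comp _ _ (fun d => x + d) C) => // d _.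
  apply: (@cvgD _ V V (nbhs d)); [exact: cvg_cst|exact: cvg_id].
- move=> u v t /= Cu Cv t01; have := Ccvx _ _ _ Cu Cv t01.
  by rewrite opprD addrACA subrr add0r addrA.
- by rewrite /= addr0.
- apply: bounded_closed_compact.
    exists L; split => [|K LK h [_ /= /le_trans]]; first exact: num_real.
    by apply; exact: ltW.
  by apply: closedI; [exact: clarke_subdiff_closed|exact: closed_norm_le].
- move=> u v t [Hu uL] [Hv vL] /[dup] t01 /andP[t0 t1]; split.
    exact: clarke_subdiff_segment_closed.
  rewrite /= (_ : _ + _ = (1 - t) *: u + t *: v); last first.
    by rewrite scalerBl scale1r scalerBr addrAC addrA.
  rewrite (le_trans (ler_normD _ _)) // !normrZ !ger0_norm // ?subr_ge0 //.
  have : (1 - t) * `|u| <= (1 - t) * L by rewrite ler_wpM2l ?subr_ge0.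
  have : t * `|v| <= t * L by rewrite ler_wpM2l.
  lra.
- move=> d /= Cd; apply: active_subgradient => // t t01; apply: HC.
  by have := Ccvx _ _ _ Cx Cd t01; rewrite (addrC x d) addrK.
exists g => //; exists (- g); last by rewrite subrr.
split => // y Cy; rewrite dotNl oppr_le0; apply: gC.
by rewrite /= addrC subrK.
Qed.

End criticality.

(** * The infinite inner loop *)

Lemma cvg0r_cvg0 (R : realType) (u_ : nat -> R) :
  u_ @ \oo --> 0^'+ -> u_ @ \oo --> 0.
Proof. by move=> u0; apply: cvg_trans u0 _; exact: cvg_within. Qed.

Section inner_loop.
Context {R : realType} {n : nat}.
Local Notation V := 'rV[R]_n.

(** The sequence of points is a parameter: [y_] gives the predicted decrease [Delta], [z_] the
    denominator [D] of both quotients. *)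
Definition model_decrease (f : V -> R) (x : V) (Q : 'M[R]_n)
    (W_ : nat -> set (R * V)) (y_ : nat -> V) (k : nat) : R :=
  f x - model2 (W_ k) Q x (y_ k).

Context {N : V -> R} (HN : is_norm N) {f : V -> R}.
Context {C : set V} (Ccvx : segment_closed C).
Context {M : R} (M0 : 0 <= M) {O : V -> V -> set (R * V)}.
Context (HO : cutting_plane_oracle N M f O).
Context {gamma gammat R1 : R} (HR1 : 0 < R1).
Context {x : V} (Cx : C x) {Q : 'M[R]_n} (HQ : posdef Q).
Context {W_ : nat -> set (R * V)} {y_ z_ g_ : nat -> V} {r_ : nat -> R}.
Context (Hloop :
  infinite_inner_loop N M f C O gamma gammat R1 Q x W_ y_ z_ g_ r_).

Local Notation A := (oracle_planes N M O x).

Local Notation Delta := (model_decrease f x Q W_ y_).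
Local Notation D := (model_decrease f x Q W_ z_).

(** * Invariants of the radii and working sets *)

Lemma radius_gt0 k : 0 < r_ k.
Proof.
elim: k => [|k IH]; first by rewrite (loop_init_radius Hloop).
by rewrite (loop_radius Hloop); case: ifP => // _; rewrite mulr_gt0.
Qed.

Lemma subgradient_le k y : C y ->
  model1 (W_ k) x (y_ k) + dot (g_ k) (y - y_ k) <= model1 (W_ k) x y.
Proof.
move=> Cy; have [Cyk _ _] := loop_tangent Hloop k.
have [sub _] := loop_subgradient Hloop k; have := sub y.
rewrite /indicator !ifT; [|exact/asboolP|exact/asboolP].
by rewrite !adde0 -EFinD lee_fin.
Qed.

Lemma working_set_exact k : W_ k `&` exactness_planes f O x !=set0.
Proof.
by case: k => [|k]; [exact: loop_init_exact Hloop|exact: loop_exact Hloop k].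
Qed.

Lemma working_set_neq0 k : W_ k !=set0.
Proof. by have [p [Wp _]] := working_set_exact k; exists p. Qed.

(** An aggregate plane need not come from the oracle, but on [C] the subgradient inequality puts it
    below the model that produced it, hence below the envelope by induction. Boundedness holds
    everywhere, as each step adds only one aggregate. *)
Lemma working_set_bounded_majorized k : planes_bounded (W_ k) x /\
  forall p y, W_ k p -> C y -> plane x p y <= model1 A x y.
Proof.
have Ab : planes_bounded A x by exact: (oracle_planes_ubound HN HO).
have Ale p y : A p -> plane x p y <= model1 A x y by exact: plane_le_model1.
elim: k => [|k [Wb Wle]].
  have W0A : W_ 0%N `<=` A by exact: (loop_init_oracle Hloop).
  split => [y|p y /W0A Ap _]; last exact: Ale.
  by have [b Ab'] := Ab y; exists b => _ [p /W0A Ap <-]; apply: Ab'; exists p.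
have Wsub p : W_ k.+1 p ->
    [\/ W_ k p, A p | p = aggregate_plane (W_ k) x (y_ k) (g_ k)].
  move=> /(loop_others Hloop) [[[Wp|Ep]|->]|Op].
  - by apply: Or31.
  - by apply: Or32; apply: oracle_exactness_planes Ep.
  - by apply: Or33.
  - by apply: Or32; exists (z_ k) => //; have [] := loop_trial Hloop k.
split => [y|p y /Wsub Wp Cy]; last first.
  case: Wp => [Wp|Ap|->]; [exact: Wle|exact: Ale|].
  rewrite plane_aggregate (le_trans (subgradient_le k y Cy)) //.
  by apply: model1_le => [|q Wq]; [exact: working_set_neq0|exact: Wle].
have [a Aa] := Ab y; have [b Wb'] := Wb y.
exists (Num.max (Num.max a b)
  (plane x (aggregate_plane (W_ k) x (y_ k) (g_ k)) y)).
move=> _ [p /Wsub Wp <-]; rewrite !le_max; case: Wp => [Wp|Ap|->].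
- by rewrite (Wb' (plane x p y)) ?orbT //; exists p.
- by rewrite (Aa (plane x p y)) //; exists p.
- by rewrite lexx orbT.
Qed.

Lemma working_set_bounded k : planes_bounded (W_ k) x.
Proof. by have [] := working_set_bounded_majorized k. Qed.

Lemma model1_le_oracle k y : C y -> model1 (W_ k) x y <= model1 A x y.
Proof.
move=> Cy; apply: model1_le; first exact: working_set_neq0.
by move=> p Wp; have [_] := working_set_bounded_majorized k; apply.
Qed.

Lemma working_set_le k p : W_ k p -> p.1 <= f x.
Proof.
move=> Wp; rewrite -(plane_at x p).
have [_ /(_ p x Wp Cx)/le_trans] := working_set_bounded_majorized k; apply.
apply: model1_le; first exact: (oracle_planes_neq0 HN HO).
by move=> a Aa; rewrite plane_at; exact: (oracle_planes_le HO x).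
Qed.

Lemma model2_at k : model2 (W_ k) Q x x = f x.
Proof.
rewrite /model2 subrr quad0 mulr0 addr0; apply/eqP; rewrite eq_le.
apply/andP; split.
  apply: model1_le; first exact: working_set_neq0.
  by move=> p Wp; rewrite plane_at; exact: working_set_le Wp.
have [p [Wp [_ <-]]] := working_set_exact k.
rewrite -(plane_at x p); apply: plane_le_model1 => //.
exact: working_set_bounded.
Qed.

Lemma predicted_decrease_ge0 k : 0 <= Delta k.
Proof.
rewrite /model_decrease -(model2_at k) subr_ge0.
have [_ _] := loop_tangent Hloop k; apply => //.
by rewrite /cball /= subrr is_norm0 // ltW // radius_gt0.
Qed.

(** If the envelope at [y] were [f x - delta], moving from [x] a fraction [t] towards [y] would
    decrease the model by [t * delta] up to order [t ^+ 2]. With [t] proportional to [s] this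
    exceeds [e * s] for small [e], against optimality of [y_ k]. *)
Lemma majorant_of_small_decrease :
  (forall e, 0 < e -> exists k s,
     [/\ 0 < s, s <= r_ k, s <= e & Delta k <= e * s]) ->
  forall y, C y -> f x <= model1 A x y.
Proof.
move=> small y Cy; rewrite leNgt; apply/negP => lt.
pose delta := f x - model1 A x y; have delta0 : 0 < delta by rewrite subr_gt0.
pose c := N (y - x) + 1; pose q := quad Q (y - x).
have q0 : 0 <= q by exact: posdef_ge0.
have Nyx : 0 <= N (y - x) by exact: is_norm_ge0.
have c1 : 1 <= c by rewrite lerDr.
have cq0 : 0 < 2 * (c + q) by lra.
(* Chosen so that [e * (c + q)] is at most half of [delta], absorbing both the decrease bound and
   the curvature. *)
pose e := Num.min 1 (delta / (2 * (c + q))).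
have e0 : 0 < e by rewrite lt_min ltr01 divr_gt0.
have ecq : e * (2 * (c + q)) <= delta.
  by rewrite -ler_pdivlMr // ge_min lexx orbT.
have e1 : e <= 1 by rewrite ge_min lexx.
have [k [s [s0 sr se Dk]]] := small e e0.
have c0 : 0 < c by lra.
(* Dividing by [c], which exceeds [N (y - x)], keeps the competitor in the trust region and gives
   [t <= s <= e]. *)
pose t := s / c; have t0 : 0 < t by rewrite divr_gt0.
have tc : t * c = s by rewrite divfK // gt_eqF.
have ts : t <= s by rewrite -tc ler_pMr.
have t01 : 0 <= t <= 1 by rewrite ltW //=; lra.
have Cu : C (x + t *: (y - x)) by exact: Ccvx.
have ball_u : cball N x (r_ k) (x + t *: (y - x)).
  rewrite /cball /= (addrC x) addrK is_norm_scale // ger0_norm ?(ltW t0) //.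
  by rewrite (le_trans _ sr) // -tc ler_wpM2l ?(ltW t0) // lerDl.
have [_ _ /(_ _ Cu ball_u)] := loop_tangent Hloop k.
have := model1_segment_le (W_ k) x (y - x) (f x) t (working_set_bounded k)
  (working_set_neq0 k) (working_set_le k) t01.
rewrite (addrC x (y - x)) subrK => seg le2.
have Wy := model1_le_oracle k y Cy.
move: Dk; rewrite /model_decrease; move: le2.
rewrite {2}/model2 (addrAC x) subrr add0r quadZ -/q => le2 Dk.
have : t * model1 (W_ k) x y <= t * model1 A x y by rewrite ler_wpM2l ?(ltW t0).
have : t ^+ 2 * q <= t * (e * q).
  rewrite expr2 -mulrA ler_wpM2l ?(ltW t0) // ler_wpM2r //.
  exact: le_trans ts se.
have : t * (e * (2 * (c + q))) <= t * delta by rewrite ler_wpM2l ?(ltW t0).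
have : 0 < t * delta by rewrite mulr_gt0.
have : 0 <= t * (e * q).
  by apply: mulr_ge0; [exact: ltW|apply: mulr_ge0 => //; exact: ltW].
move: Dk seg; rewrite -tc /delta; lra.
Qed.

(** With an unchanged radius [y_ k.+1] lies in the old ball, so the normal vector [v] has
    nonpositive product with the step. The aggregate plane bounds the new model from below, and
    expanding the quadratic at [y_ k] leaves exactly the gain term. *)
Lemma predicted_decrease_descent k : r_ k.+1 = r_ k ->
  Delta k.+1 + 2^-1 * quad Q (y_ k.+1 - y_ k) <= Delta k.
Proof.
move=> rk; have [Cy' By' _] := loop_tangent Hloop k.+1.
have [_ [v [_ Nv] gv]] := loop_subgradient Hloop k.
rewrite rk in By'; have {}Nv := Nv _ By'.
have := plane_le_model1 (W_ k.+1) x _ (y_ k.+1) (working_set_bounded _)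
  (loop_aggregate Hloop k).
rewrite plane_aggregate /Delta /model2 => agg.
have -> : y_ k.+1 - x = (y_ k - x) + (y_ k.+1 - y_ k).
  by rewrite [RHS]addrC addrA subrK.
rewrite (quadD Q (y_ k - x)) ?(proj1 HQ) //.
have := congr1 (fun w => dot w (y_ k.+1 - y_ k)) gv.
rewrite !(dotDl _ _ (y_ k.+1 - y_ k)) (dotC 0) dot0r.
move: Nv agg; lra.
Qed.

(** The trial point may leave the trust region by [nu]. Shrinking it towards [x] by [1 + nu / r_ k]
    brings it back, and convexity of the model bounds the loss by the same factor. *)
Lemma trial_decrease_le k (nu : R) : 0 <= nu -> cball N (y_ k) nu (z_ k) ->
  D k <= (1 + nu / r_ k) * Delta k.
Proof.
move=> nu0 znu; have [Cy By min_y] := loop_tangent Hloop k.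
have [Cz _] := loop_trial Hloop k; have r0 := radius_gt0 k.
pose s := 1 + nu / r_ k; have s1 : 1 <= s by rewrite lerDl divr_ge0 // ltW.
have s0 : 0 < s by lra.
have si01 : 0 <= s^-1 <= 1 by rewrite invr_ge0 ltW //= invf_le1.
have Cu : C (x + s^-1 *: (z_ k - x)) by exact: Ccvx.
have Bu : cball N x (r_ k) (x + s^-1 *: (z_ k - x)).
  rewrite /cball /= (addrC x) addrK is_norm_scale //.
  rewrite ger0_norm ?invr_ge0 ?(ltW s0) //.
  rewrite ler_pdivrMl //.
  have -> : z_ k - x = (z_ k - y_ k) + (y_ k - x) by rewrite addrA subrK.
  rewrite (le_trans (is_norm_triangle HN _ _)) // mulrDl mul1r divfK ?gt_eqF //.
  by rewrite addrC lerD.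
have := min_y _ Cu Bu.
have := model2_segment_le (W_ k) Q x (z_ k - x) (f x) s^-1
  (fun h => posdef_ge0 Q h HQ) (working_set_bounded k)
  (working_set_neq0 k) (working_set_le k) si01.
rewrite [in X in _ <= X](addrC x) subrK -/s => H1 H2.
have : Delta k >= s^-1 * D k by rewrite /model_decrease; lra.
by rewrite ler_pdivrMl.
Qed.

(* At z_ k the planes of W_ k and the aggregate plane stay below model1 (W_ k),
   which is too low, so model1 (W_ k.+1) is realised there by oracle planes,
   whose slopes are bounded; the aggregate slopes g_ k need not be. *)
Lemma predicted_decrease_next k (L : R) :
  (forall p, A p -> `|p.2| <= L) -> gammat <= 1 -> 0 < D k ->
  rhot f (W_ k) (W_ k.+1) Q x (z_ k) < gammat ->
  Delta k.+1 <= gammat * D k + n%:R * (L * `|z_ k - y_ k.+1|).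
Proof.
move=> HL gt1 D0; rewrite /rhot -/(D k) ltr_pdivrMr // => Hrho.
have [Cz zM] := loop_trial Hloop k.
have [p Wp pz] : exists2 p, W_ k.+1 p & f x - gammat * D k < plane x p (z_ k).
  apply: contrapT => nex.
  have : model1 (W_ k.+1) x (z_ k) <= f x - gammat * D k.
    apply: model1_le; first exact: working_set_neq0.
    by move=> p Wp; rewrite leNgt; apply/negP => lt; apply: nex; exists p.
  by move: Hrho; lra.
have low : model1 (W_ k) x (z_ k) <= f x - gammat * D k.
  have : gammat * D k <= 1 * D k by rewrite ler_wpM2r // ltW.
  have := posdef_ge0 Q (z_ k - x) HQ.
  by rewrite {2}/model_decrease /model2; lra.
have Ap : A p.
  move: (Wp) => /(loop_others Hloop) [[[Wkp|Ep]|/= pE]|Op].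
  - have := plane_le_model1 (W_ k) x p (z_ k) (working_set_bounded k) Wkp.
    by move: low pz; lra.
  - exact: oracle_exactness_planes Ep.
  - have := subgradient_le k (z_ k) Cz.
    by move: low pz; rewrite pE plane_aggregate; lra.
  - by exists (z_ k).
have := plane_le_model1 (W_ k.+1) x p (y_ k.+1) (working_set_bounded _) Wp.
have := plane_sub x p (z_ k) (y_ k.+1).
have := dot_norm_le p.2 (z_ k - y_ k.+1).
have : n%:R * (`|p.2| * `|z_ k - y_ k.+1|) <= n%:R * (L * `|z_ k - y_ k.+1|).
  by rewrite ler_wpM2l // ler_wpM2r // HL.
have := posdef_ge0 Q (y_ k.+1 - x) HQ.
rewrite {1}/model_decrease {1}/model2; move: pz; lra.
Qed.

(** * Radii tending to zero and radii eventually constant *)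

Lemma radius_nonincreasing k : r_ k.+1 <= r_ k.
Proof.
rewrite (loop_radius Hloop); case: ifP => // _; have := radius_gt0 k; lra.
Qed.

(** A positive limit is impossible: once the radius is below twice the limit, one more halving would
    pass under it. *)
Lemma radius_cvg0 :
  (forall K, exists2 k, (K <= k)%N &
     gammat <= rhot f (W_ k) (W_ k.+1) Q x (z_ k)) ->
  r_ @ \oo --> 0.
Proof.
move=> often.
have rmono : nonincreasing_seq r_.
  by apply/nonincreasing_seqP; exact: radius_nonincreasing.
have rc : cvgn r_.
  apply: nonincreasing_is_cvgn => //; exists 0 => _ [k _ <-].
  by rewrite ltW // radius_gt0.
have rge k : limn r_ <= r_ k by exact: nonincreasing_cvgn_ge.
suff l0 : limn r_ = 0 by rewrite -l0.
have l_ge0 : 0 <= limn r_.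
  by apply: limr_ge => //; apply: nearW => k; rewrite ltW // radius_gt0.
apply/eqP; rewrite eq_le l_ge0 andbT leNgt; apply/negP => l_gt0.
have [K _ HK] : \forall k \near \oo, r_ k < 2 * limn r_.
  by apply: cvgr_lt; [exact: rc|lra].
have [k Kk gk] := often K.
have := rge k.+1; have := HK k Kk.
rewrite /= (loop_radius Hloop) ifF; last first.
  by apply/negbTE; rewrite -leNgt.
lra.
Qed.

Context (gamma0 : 0 < gamma) (gamma_lt : gamma < gammat).
Context (gammat_lt1 : gammat < 1).
Context {theta : R} (theta0 : 0 < theta).
Context (Htheta : forall k, theta * Delta k <= D k).

(** At a halving, [z_ k] is rejected although the new model predicts well there. The plane from
    [oracle3] belongs to [W_ k.+1], so the gap [(gammat - gamma) * D k] is at most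
    [eps_ k * N (z_ k - x)], which is o of the radius. *)
Lemma small_decrease_shrinking (Theta : R) : 0 <= Theta ->
  (forall k, N (z_ k - x) <= Theta * N (y_ k - x)) ->
  (forall k, 0 < D k) ->
  (forall K, exists2 k, (K <= k)%N &
     gammat <= rhot f (W_ k) (W_ k.+1) Q x (z_ k)) ->
  forall e, 0 < e -> exists k s,
     [/\ 0 < s, s <= r_ k, s <= e & Delta k <= e * s].
Proof.
move=> Theta0 HTheta D0 often e e0.
have rc := radius_cvg0 often.
have zr k : N (z_ k - x) <= Theta * r_ k.
  rewrite (le_trans (HTheta k)) // ler_wpM2l //.
  by have [] := loop_tangent Hloop k.
have zc : z_ @ \oo --> x.
  have [c c0 Nc] := norm_le_is_norm HN.
  apply/cvgrPdist_lt => d d0.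
  have cr : c * (Theta * r_ k) @[k --> \oo] --> 0.
    rewrite -(mulr0 c) -(mulr0 Theta).
    by apply: cvgM; [exact: cvg_cst|apply: cvgM => //; exact: cvg_cst].
  have [K _ HK] : \forall k \near \oo, c * (Theta * r_ k) < d.
    exact: (cvgr_lt _ cr).
  exists K => // k Kk /=; rewrite distrC (le_lt_trans _ (HK k Kk)) //=.
  by rewrite (le_trans (Nc _)) // ler_pM2l.
have [p_ [eps_ [Hp /cvg0r_cvg0 eps0 Heps]]] := oracle3 HO zc.
(* [B] collects the constants in the final bound of [Delta k] by [|eps_ k| * B * r_ k]. *)
pose B := Theta / (theta * (gammat - gamma)).
have tg0 : 0 < theta * (gammat - gamma) by rewrite mulr_gt0 // subr_gt0.
have B0 : 0 <= B by rewrite divr_ge0 // ltW.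
have [K1 _ HK1] : \forall k \near \oo, r_ k < e by exact: (cvgr_lt _ rc).
have [K2 _ HK2] : \forall k \near \oo, `|eps_ k| < e / (1 + B).
  by apply: (@cvgr0_norm_lt _ _ _ _ _ _ eps0); rewrite divr_gt0 // ltr_pwDl.
have [k] := often (maxn K1 K2); rewrite geq_max => /andP[Kk1 Kk2] gk.
exists k, (r_ k); split; [exact: radius_gt0|by []|exact/ltW/HK1|].
have r0 := radius_gt0 k.
have /negP := @loop_rejected _ _ _ _ _ _ _ _ _ _ _ _ _ _ _ _ _ Hloop k.
rewrite -ltNge /rho -/(D k) ltr_pdivrMr // => fz.
move: gk; rewrite /rhot -/(D k) ler_pdivlMr // => phi.
have Wp : W_ k.+1 (p_ k) by apply: (loop_cutting Hloop); exact: Hp.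
have pz := plane_le_model1 (W_ k.+1) x (p_ k) (z_ k) (working_set_bounded _) Wp.
have epsN : eps_ k * N (z_ k - x) <= `|eps_ k| * (Theta * r_ k).
  apply: (@le_trans _ _ (`|eps_ k| * N (z_ k - x))).
    by rewrite ler_wpM2r ?ler_norm // is_norm_ge0.
  by rewrite ler_wpM2l.
have gD : (gammat - gamma) * D k <= `|eps_ k| * (Theta * r_ k).
  by have := Heps k; lra.
have : theta * (gammat - gamma) * Delta k <= `|eps_ k| * (Theta * r_ k).
  apply: le_trans gD; rewrite mulrAC mulrC ler_wpM2l ?Htheta // subr_ge0.
  exact: ltW.
rewrite -ler_pdivlMl // => /le_trans; apply.
have -> : (theta * (gammat - gamma))^-1 * (`|eps_ k| * (Theta * r_ k))
    = `|eps_ k| * B * r_ k by rewrite /B; ring.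
rewrite ler_pM2r // (@le_trans _ _ (`|eps_ k| * (1 + B))) //.
  by rewrite ler_wpM2l // lerDr.
by rewrite -ler_pdivlMr ?ltr_pwDl //; exact/ltW/HK2.
Qed.

(** From [K] on the decreases are nonincreasing, hence converge to some [l]; the null-step
    inequality in the limit reads [l <= gammat * l], forcing [l = 0]. *)
Lemma small_decrease_stationary (nu_ : nat -> R) (K : nat) :
  nu_ @ \oo --> 0 -> (forall k, cball N (y_ k) (nu_ k) (z_ k)) ->
  (forall k, 0 < D k) ->
  (forall k, (K <= k)%N -> rhot f (W_ k) (W_ k.+1) Q x (z_ k) < gammat) ->
  forall e, 0 < e -> exists k s,
     [/\ 0 < s, s <= r_ k, s <= e & Delta k <= e * s].
Proof.
(* Here [rho] names the radius that is constant from [K] on, not the acceptance quotient. *)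
move=> nu0 Hnu D0 null e e0; pose rho := r_ K.
have rho0 : 0 < rho by exact: radius_gt0.
have gK j : rhot f (W_ (j + K)%N) (W_ (j + K).+1) Q x (z_ (j + K)%N) < gammat.
  by apply: null; exact: leq_addl.
have rK j : r_ (j + K)%N = rho.
  by elim: j => // j IH; rewrite addSn (loop_radius Hloop) gK.
pose u j := Delta (j + K)%N.
have u0 j : 0 <= u j by exact: predicted_decrease_ge0.
have descent j : u j.+1 + 2^-1 * quad Q (y_ (j + K).+1 - y_ (j + K)%N) <= u j.
  by apply: predicted_decrease_descent; rewrite -addSn !rK.
have umono : nonincreasing_seq u.
  apply/nonincreasing_seqP => j; have := descent j.
  by have := posdef_ge0 Q (y_ (j + K).+1 - y_ (j + K)%N) HQ; lra.
have uc : cvgn u.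
  by apply: nonincreasing_is_cvgn => //; exists 0 => _ [k _ <-]; exact: u0.
pose l := limn u; have l0 : 0 <= l by apply: limr_ge => //; exact: nearW.
have [L L0 HL] := oracle_planes_slope_bound HN HO x.
have [c c0 Nc] := norm_le_is_norm HN.
have [a a0 Qa] := posdef_lower_bound Q HQ.
have nu_ge0 k : 0 <= nu_ k by apply: le_trans (Hnu k); exact: is_norm_ge0.
(* [v] is the slack in the bound on [u j.+1]; the square root bounds the step between successive
   [y_], by [descent] and the lower bound [Qa]. *)
pose v j := gammat * ((1 + nu_ (j + K)%N / rho) * u j)
  + n%:R * (L * (c * nu_ (j + K)%N + Num.sqrt (2 / a * (u j - u j.+1))))
  - u j.+1.
have v0 j : 0 <= v j.
  rewrite subr_ge0.
  have := predicted_decrease_next (j + K) L HL (ltW gammat_lt1) (D0 _) (gK j).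
  move=> /le_trans; apply.
  apply: lerD.
    rewrite ler_wpM2l // ?(ltW (lt_trans gamma0 gamma_lt)) // -(rK j).
    exact: trial_decrease_le.
  rewrite ler_wpM2l // ler_wpM2l //.
  have -> : z_ (j + K)%N - y_ (j + K).+1
      = (z_ (j + K)%N - y_ (j + K)%N) - (y_ (j + K).+1 - y_ (j + K)%N).
    by rewrite opprB addrA subrK.
  rewrite (le_trans (ler_normB _ _)) // lerD //.
    by rewrite (le_trans (Nc _)) // ler_pM2l //; exact: Hnu.
  rewrite -[leLHS]ger0_norm // -sqrtr_sqr ler_wsqrtr //.
  rewrite mulrAC ler_pdivlMr // mulrC.
  by have := descent j; have := Qa (y_ (j + K).+1 - y_ (j + K)%N); lra.
have nuK : nu_ (j + K)%N @[j --> \oo] --> 0 by rewrite (cvg_shiftn K nu_).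
have uS : u j.+1 @[j --> \oo] --> l by rewrite (cvg_shiftS u).
have vl : v j @[j --> \oo] -->
    gammat * ((1 + 0 / rho) * l)
    + n%:R * (L * (c * 0 + Num.sqrt (2 / a * (l - l)))) - l.
  apply: cvgB => //; apply: cvgD.
    apply: cvgM; first exact: cvg_cst.
    apply: cvgM => //; apply: cvgD; first exact: cvg_cst.
    by apply: cvgM => //; exact: cvg_cst.
  apply: cvgM; first exact: cvg_cst.
  apply: cvgM; first exact: cvg_cst.
  apply: cvgD; first by apply: cvgM => //; exact: cvg_cst.
  apply: continuous_cvg; first exact: sqrt_continuous.
  by apply: cvgM; [exact: cvg_cst|exact: cvgB].
have : 0 <= gammat * ((1 + 0 / rho) * l)
    + n%:R * (L * (c * 0 + Num.sqrt (2 / a * (l - l)))) - l.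
  by apply: cvgr_to_ge vl _; exact: nearW.
rewrite subrr !mulr0 mul0r sqrtr0 !addr0 !mulr0 mul1r addr0 => Hl.
have {Hl}l_eq0 : l = 0.
  apply/eqP; rewrite eq_le l0 andbT leNgt; apply/negP => l_gt0.
  have : gammat * l < 1 * l by rewrite ltr_pM2r.
  lra.
have s0 : 0 < Num.min e rho by rewrite lt_min e0.
have [j _ Hj] : \forall j \near \oo, u j < e * Num.min e rho.
  by apply: (cvgr_lt _ uc); rewrite -/l l_eq0 mulr_gt0.
exists (j + K)%N, (Num.min e rho); split => //.
- by rewrite rK ge_min lexx orbT.
- by rewrite ge_min lexx.
- by apply: ltW; apply: Hj => /=.
Qed.

End inner_loop.

Theorem lemma5p9 (R : realType) (n : nat)
    (N : 'rV[R]_n -> R) (HN : is_norm N)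
    (f : 'rV[R]_n -> R) (Hf : locally_lipschitz f)
    (C : set 'rV[R]_n) (HCclosed : closed C)
    (HCconvex : convex_set (C : set (convex_lmodType 'rV[R]_n)))
    (M : R) (HM : 0 < M)
    (O : 'rV[R]_n -> 'rV[R]_n -> set (R * 'rV[R]_n))
    (HO : cutting_plane_oracle N M f O)
    (gamma gammat theta Theta q R1 : R)
    (Hgamma : 0 < gamma) (Hgammat : gamma < gammat) (Hgammat1 : gammat < 1)
    (Htheta : 0 < theta) (Htheta1 : theta < 1) (HTheta : 1 <= Theta)
    (Hq : 0 < q) (HR1 : 0 < R1)
    (x : 'rV[R]_n) (Hx : C x)
    (Q : 'M[R]_n) (HQ : posdef Q) (HQq : opnorm N Q <= q)
    (W_ : nat -> set (R * 'rV[R]_n)) (y_ z_ g_ : nat -> 'rV[R]_n)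
    (r_ nu_ : nat -> R)
    (Hnu : nu_ @ \oo --> 0^'+)
    (Hloop : infinite_inner_loop N M f C O gamma gammat R1 Q x W_ y_ z_ g_ r_)
    (Hznu : forall k, cball N (y_ k) (nu_ k) (z_ k))
    (Hztheta : forall k, theta * (f x - model2 (W_ k) Q x (y_ k))
                         <= f x - model2 (W_ k) Q x (z_ k))
    (HzTheta : forall k, N (z_ k - x) <= Theta * N (y_ k - x)) :
  critical_point f C x.
Proof.
have Ccvx := convex_set_segment_closed C HCconvex.
have M0 : 0 <= M by exact: ltW.
apply: (critical_point_majorant HN HO C x M0 HCclosed Ccvx Hx).
apply: (majorant_of_small_decrease HN Ccvx M0 HO Hx HQ Hloop).
have r0 := radius_gt0 HR1 Hloop.
(* A nonpositive decrease satisfies the smallness condition at once; otherwise both quotients have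
   positive denominators, and their tests can be cleared of division. *)
have [[k Dk0]|Dpos] := pselect (exists k, model_decrease f x Q W_ y_ k <= 0).
  move=> e e0; exists k, (Num.min e (r_ k)); split.
  - by rewrite lt_min e0 r0.
  - by rewrite ge_min lexx orbT.
  - by rewrite ge_min lexx.
  - by rewrite (le_trans Dk0) // mulr_ge0 ?(ltW e0) // le_min !ltW.
have D0 k : 0 < model_decrease f x Q W_ z_ k.
  apply: lt_le_trans (Hztheta k); rewrite mulr_gt0 // ltNge; apply/negP => le0.
  by apply: Dpos; exists k.
have [[K null]|often] := pselect (exists K, forall k, (K <= k)%N ->
    rhot f (W_ k) (W_ k.+1) Q x (z_ k) < gammat).
  exact: (small_decrease_stationary HN Ccvx M0 HO HR1 Hx HQ Hloop Hgamma
    Hgammat Hgammat1 nu_ K (cvg0r_cvg0 _ _ Hnu) Hznu D0 null).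
apply: (small_decrease_shrinking HN M0 HO HR1 Hloop Hgammat Htheta
  Hztheta Theta _ HzTheta D0).
  exact: le_trans HTheta.
move=> K; apply: contrapT => nex; apply: often; exists K => k Kk.
by rewrite ltNge; apply/negP => gk; apply: nex; exists k.
Qed.
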